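(* For any nonnegative integers $l$ and $n$, the set $$\{T_l(\pi):\pi\in S_n,\ \ell^-(\pi)\le l\}$$ is a basis of $C_n(U(l))$ (i.e. the operators $T_l(\pi)$, indexed by the $\pi\in S_n$ with $\ell^-(\pi)\le l$, are linearly independent and span $C_n(U(l))$).
   Context: $C_n(U(l))$ is the space of linear operators on $(\mathbb C^l)^{\otimes n}$ commuting with $U^{\otimes n}$ for all $U\in U(l)$. For $\pi\in S_n$, $T_l(\pi)$ is the operator on $(\mathbb C^l)^{\otimes n}$ given by $T_l(\pi)(v_1\otimes\cdots\otimes v_n)=v_{\pi(1)}\otimes\cdots\otimes v_{\pi(n)}$. $\ell^-(\pi)$ is the length of the longest decreasing subsequence of $\pi$. *)

(* Defs.v *)
From mathcomp Require Import all_boot all_order all_algebra all_fingroup.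
From HB Require Import structures.
From mathcomp Require Import spectral reals complex.

Set Implicit Arguments.
Unset Strict Implicit.
Unset Printing Implicit Defensive.

Import Order.TTheory GRing.Theory Num.Theory.
Local Open Scope ring_scope.

(* (C^l)^{\otimes n} in coordinates: [t f] is the coefficient of t on
   e_{f 0} \otimes ... \otimes e_{f (n-1)}, where e is the standard basis of
   C^l. *)
Definition tensor_space (R : realType) (l n : nat) : vectType R[i] :=
  {ffun {ffun 'I_n -> 'I_l} -> R[i]^o}.

Section Operators.
Variables (R : realType) (l n : nat).
Local Notation C := R[i].
Local Notation V := (tensor_space R l n).

Definition pure_tensor (v : 'I_n -> 'cV[C]_l) : V :=
  [ffun f : {ffun 'I_n -> 'I_l} => \prod_(i < n) v i (f i) 0].

Definition tensor_power_fun (U : 'M[C]_l) (t : V) : V :=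
  [ffun f : {ffun 'I_n -> 'I_l} =>
     \sum_(g : {ffun 'I_n -> 'I_l}) (\prod_(i < n) U (f i) (g i)) * t g].

Fact tensor_power_fun_is_linear U : linear (tensor_power_fun U).
Proof.
move=> a s t; apply/ffunP=> f; rewrite !ffunE scaler_sumr -big_split /=.
by apply: eq_bigr => g _; rewrite !ffunE mulrDr /GRing.scale /= mulrCA.
Qed.

HB.instance Definition _ U :=
  GRing.isLinear.Build C V V _ (tensor_power_fun U)
    (tensor_power_fun_is_linear U).

Definition tensor_power (U : 'M[C]_l) : 'End(V) := linfun (tensor_power_fun U).

(* The coefficient of v_{pi 0} \otimes ... \otimes v_{pi (n-1)} at f is
   \prod_i v_{pi i} (f i) = \prod_j v_j (f (pi^-1 j)); see permopE. *)
Definition permop_fun (pi : 'S_n) (t : V) : V :=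
  [ffun f : {ffun 'I_n -> 'I_l} => t [ffun j => f ((pi^-1)%g j)]].

Fact permop_fun_is_linear pi : linear (permop_fun pi).
Proof. by move=> a s t; apply/ffunP=> f; rewrite !ffunE. Qed.

HB.instance Definition _ pi :=
  GRing.isLinear.Build C V V _ (permop_fun pi) (permop_fun_is_linear pi).

Definition permop (pi : 'S_n) : 'End(V) := linfun (permop_fun pi).

Definition unitary_commutant (A : 'End(V)) : Prop :=
  forall U : 'M[C]_l, U \is unitarymx ->
    (A \o tensor_power U = tensor_power U \o A)%VF.

(* Pure tensors span, so tensor_powerE and permopE determine the two
   operators. *)
Lemma tensor_spaceE (t : V) :
  t = \sum_(f : {ffun 'I_n -> 'I_l})
        t f *: pure_tensor (fun i => delta_mx (f i) 0).
Proof.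
apply/ffunP=> g; rewrite sum_ffunE (bigD1 g) //= !ffunE.
rewrite big1 ?big1 ?addr0; first by rewrite /GRing.scale /= mulr1.
- move=> f neq_fg; rewrite !ffunE.
  have [i neq_i] : exists i, g i != f i.
    apply/existsP; apply: contraNT neq_fg; rewrite negb_exists => /forallP eq_fg.
    by apply/eqP/ffunP=> i; apply/esym/eqP; rewrite -[_ == _]negbK.
  by rewrite (bigD1 i) //= mxE (negPf neq_i) mul0r scaler0.
- by move=> i _; rewrite mxE !eqxx.
Qed.

Lemma tensor_powerE (U : 'M[C]_l) (v : 'I_n -> 'cV[C]_l) :
  tensor_power U (pure_tensor v) = pure_tensor (fun i => U *m v i).
Proof.
rewrite lfunE /=; apply/ffunP=> f; rewrite !ffunE.
under [RHS]eq_bigr => i _ do rewrite mxE.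
rewrite bigA_distr_bigA /=; apply: eq_bigr => g _.
by rewrite ffunE -big_split.
Qed.

Lemma permopE (pi : 'S_n) (v : 'I_n -> 'cV[C]_l) :
  permop pi (pure_tensor v) = pure_tensor (fun i => v (pi i)).
Proof.
rewrite lfunE /=; apply/ffunP=> f; rewrite !ffunE.
rewrite (reindex_inj (@perm_inj _ pi)) /=.
by apply: eq_bigr => i _; rewrite ffunE permK.
Qed.

End Operators.

(* A decreasing subsequence of pi is given by its set A of positions. *)
Definition decreasing_on (n : nat) (pi : 'S_n) (A : {set 'I_n}) : bool :=
  [forall i in A, forall j in A, (i < j)%N ==> (pi j < pi i)%N].

Definition longest_decreasing (n : nat) (pi : 'S_n) : nat :=
  \max_(A : {set 'I_n} | decreasing_on pi A) #|A|.

(* Main.v *)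
(* A permutation operator has matrix entry [f = g \o p] at the multi-indices
   (f, g), which reduces everything to counting words.

   Independence: colour each position of p by the length of the longest
   decreasing subsequence ending there.  At most l colours occur, and p is
   increasing on each colour class, so the matrix entry at (c, c \o p^-1), with
   c the colouring, vanishes on every permutation that is not lexicographically
   at least p.

   Straightening: the antisymmetrizer over more than l positions is zero, so a
   p decreasing on such a set of positions is a combination of lexicographically
   smaller permutations.

   Commutant: an operator commuting with U^{\otimes n} for U unitary commutes
   with M^{\otimes n} for M normal (spectral theorem, moving one eigenvalue at a
   time off the unit circle), hence for all M = X + 'i Y (polynomials in t
   vanishing on X + t Y for t real), hence, by polarization, with the
   symmetrization over S_n of every matrix unit.  Contracting the latter
   relation against a solution y of a Gram system exhibits the operator as a
   combination of permutation operators. *)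
Require Import Defs.
From mathcomp Require Import all_boot all_order all_algebra all_fingroup.
From mathcomp Require Import ring.
From mathcomp Require Import sesquilinear spectral reals complex.

Set Implicit Arguments.
Unset Strict Implicit.
Unset Printing Implicit Defensive.

Import Order.TTheory GRing.Theory Num.Theory.
Local Open Scope ring_scope.

(** * Kronecker deltas and matrix entries of operators *)

Lemma sum_delta (C : pzSemiRingType) (I : finType) (F : I -> C) i :
  \sum_j F j * (j == i)%:R = F i.
Proof.
rewrite (bigD1 i) //= eqxx mulr1 big1 ?addr0 // => j /negPf ->.
by rewrite mulr0.
Qed.

Lemma prod_delta (C : comPzSemiRingType) (I : finType) (T : eqType)
    (f g : {ffun I -> T}) :
  \prod_i (f i == g i)%:R = (f == g)%:R :> C.
Proof.
case: eqP => [->|/eqP neq_fg]; first by rewrite big1 // => i _; rewrite eqxx.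
have [i /negPf neq_i] : exists i, f i != g i.
  apply/existsP; apply: contraNT neq_fg; rewrite negb_exists.
  by move=> /forallP eq_fg; apply/eqP/ffunP=> i; apply/eqP; rewrite -[_ == _]negbK.
by rewrite (bigD1 i) //= neq_i mul0r.
Qed.

Section Coefficients.
Variables (R : realType) (l n : nat).
Local Notation C := R[i].
Local Notation V := (tensor_space R l n).
Local Notation F := {ffun 'I_n -> 'I_l}.

(** The entry of the matrix of [A] in row [f] and column [g]. *)
Definition tcoef (A : 'End(V)) (f g : F) : C :=
  A [ffun h : F => (h == g)%:R : C^o] f.

Lemma tcoefE (A : 'End(V)) (t : V) f : A t f = \sum_g tcoef A f g * t g.
Proof.
have -> : t = \sum_(g : F) t g *: [ffun h : F => (h == g)%:R : C^o].
  apply/ffunP=> h; rewrite sum_ffunE -[LHS]sum_delta.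
  by apply: eq_bigr => g _; rewrite !ffunE eq_sym.
rewrite linear_sum sum_ffunE; apply: eq_bigr => g _.
rewrite linearZ ffunE mulrC -/(tcoef A f g); congr (_ * _).
rewrite sum_ffunE -[LHS]sum_delta.
by apply: eq_bigr => h _; rewrite !ffunE eq_sym.
Qed.

Lemma tcoef_inj A B : (forall f g, tcoef A f g = tcoef B f g) -> A = B.
Proof.
move=> eqAB; apply/lfunP=> t; apply/ffunP=> f; rewrite !tcoefE.
by apply: eq_bigr => g _; rewrite eqAB.
Qed.

Lemma tcoef_comp (A B : 'End(V)) f g :
  tcoef (A \o B)%VF f g = \sum_h tcoef A f h * tcoef B h g.
Proof. by rewrite /tcoef comp_lfunE tcoefE. Qed.

Lemma tcoef_sum (I : finType) (P : pred I) (c : I -> C) (A : I -> 'End(V)) f g :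
  tcoef (\sum_(i | P i) c i *: A i) f g = \sum_(i | P i) c i * tcoef (A i) f g.
Proof.
rewrite /tcoef sum_lfunE sum_ffunE.
by apply: eq_bigr => i _; rewrite scale_lfunE ffunE.
Qed.

Lemma tcoef_tensor_power U f g :
  tcoef (tensor_power n U) f g = \prod_i U (f i) (g i).
Proof.
rewrite /tcoef lfunE ffunE -[RHS](sum_delta (fun h : F => \prod_i U (f i) (h i))).
by apply: eq_bigr => h _; rewrite ffunE.
Qed.

Definition permf (f : F) (s : 'S_n) : F := [ffun j => f (s j)].

Lemma permfM f s t : permf (permf f s) t = permf f (t * s)%g.
Proof. by apply/ffunP=> j; rewrite !ffunE permM. Qed.

Lemma permf1 f : permf f 1%g = f.
Proof. by apply/ffunP=> j; rewrite !ffunE perm1. Qed.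

Lemma permfK s : cancel (permf^~ s) (permf^~ s^-1%g).
Proof. by move=> f; rewrite permfM mulVg permf1. Qed.

Lemma permfVK s : cancel (permf^~ s^-1%g) (permf^~ s).
Proof. by move=> f; rewrite permfM mulgV permf1. Qed.

Lemma tcoef_permop (s : 'S_n) f g : tcoef (permop R l s) f g = (f == permf g s)%:R.
Proof.
rewrite /tcoef lfunE !ffunE; congr ((_ : bool)%:R).
by apply/eqP/eqP=> [<-|->]; rewrite -/(permf _ s^-1%g) ?permfVK ?permfK.
Qed.

Lemma permopM (s t : 'S_n) : permop R l (s * t) = (permop R l s \o permop R l t)%VF.
Proof.
apply: tcoef_inj => f g; rewrite tcoef_comp.
under eq_bigr => h _ do rewrite [tcoef _ h g]tcoef_permop.
by rewrite sum_delta !tcoef_permop permfM.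
Qed.

Lemma unitary_commutant_span (X : seq 'End(V)) :
    (forall A, A \in X -> unitary_commutant A) ->
  forall A, A \in <<X>>%VS -> unitary_commutant A.
Proof.
move=> commX A /(coord_span (X := in_tuple X)) -> U unitaryU.
elim/big_ind: _ => [|A1 A2 eq1 eq2|i _]; first by rewrite comp_lfun0l comp_lfun0r.
  by rewrite comp_lfunDl comp_lfunDr eq1 eq2.
by rewrite -comp_lfunZl -comp_lfunZr commX // mem_nth.
Qed.

Lemma permop_commutant (s : 'S_n) : unitary_commutant (permop R l s).
Proof.
move=> U _; apply: tcoef_inj => f g; rewrite !tcoef_comp.
under [RHS]eq_bigr => h _ do rewrite tcoef_permop.
rewrite sum_delta.
rewrite (bigD1 (permf f s^-1%g)) //= big1 ?addr0.
  rewrite tcoef_permop permfVK eqxx mul1r !tcoef_tensor_power.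
  rewrite (reindex_inj (@perm_inj _ s)); apply: eq_bigr => i _.
  by rewrite !ffunE permK.
move=> h /negPf neq_h; rewrite tcoef_permop.
case: eqP => [eq_f|_]; last by rewrite mul0r.
by rewrite eq_f permfK eqxx in neq_h.
Qed.

End Coefficients.

(** * Lexicographic order and decreasing subsequences *)

Lemma strict_order_ind (T : finType) (r : rel T) (P : T -> Prop) :
    irreflexive r -> transitive r ->
    (forall y, (forall x, r x y -> P x) -> P y) -> forall y, P y.
Proof.
move=> r_irr r_trans IH y; have [m] := ubnP #|[pred x | r x y]|.
elim: m y => // m IHm y; rewrite ltnS => le_ym; apply: IH => x rxy.
apply: IHm; apply: leq_trans le_ym; apply/proper_card/properP; split.
  by apply/subsetP=> z; rewrite !inE => /r_trans; apply.
by exists x; rewrite !inE // r_irr.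
Qed.

Section Lexicographic.
Variable n : nat.
Implicit Types (s t p : 'S_n) (A : {set 'I_n}).

Definition lex_lt s t : bool :=
  [exists i, (s i < t i)%N && [forall j : 'I_n, (j < i)%N ==> (s j == t j)]].

Lemma lex_ltP s t :
  reflect (exists2 i, (s i < t i)%N & forall j : 'I_n, (j < i)%N -> s j = t j)
          (lex_lt s t).
Proof.
apply: (iffP existsP) => [[i /andP[lt_i /forallP eq_lt]]|[i lt_i eq_lt]]; exists i.
- by [].
- by move=> j lt_ji; apply/eqP; exact: (implyP (eq_lt j)).
by rewrite lt_i; apply/forallP=> j; apply/implyP=> /eq_lt ->.
Qed.

Lemma lex_lt_irr : irreflexive lex_lt.
Proof. by move=> s; apply/lex_ltP=> -[k]; rewrite ltnn. Qed.

Lemma lex_lt_trans : transitive lex_lt.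
Proof.
move=> t s p /lex_ltP[i lt_i eq_i] /lex_ltP[j lt_j eq_j]; apply/lex_ltP.
case: (ltngtP i j) => [ij|ji|/val_inj ij].
- exists i; first by rewrite -eq_j.
  by move=> k ki; rewrite eq_i // eq_j // (ltn_trans ki).
- exists j; first by rewrite eq_i.
  by move=> k kj; rewrite eq_i ?eq_j // (ltn_trans kj).
- exists i; first by rewrite (ltn_trans lt_i) // ij.
  by move=> k ki; rewrite eq_i // eq_j // -ij.
Qed.

(** The least moved point goes up, because all smaller values are already taken by fixed points. *)
Lemma first_moved s : s != 1%g ->
  exists2 i : 'I_n, (i < s i)%N & forall j : 'I_n, (j < i)%N -> s j = j.
Proof.
move=> s_neq1; have [i0 mov_i0] : exists i, s i != i.
  apply/existsP; apply: contraNT s_neq1; rewrite negb_exists => /forallP fix_s.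
  by apply/eqP/permP=> i; rewrite perm1; apply/eqP; rewrite -[_ == _]negbK.
have [i mov_i min_i] :=
  @arg_minnP _ i0 (fun i => s i != i) (fun i : 'I_n => i : nat) mov_i0.
have fix_lt (j : 'I_n) : (j < i)%N -> s j = j.
  by move=> ji; apply/eqP; apply: contraLR ji => /min_i; rewrite -leqNgt.
exists i => //; case: ltngtP => // [lt_si|/val_inj eq_si].
  by have /perm_inj eq_si := fix_lt _ lt_si; rewrite eq_si eqxx in mov_i.
by rewrite -eq_si eqxx in mov_i.
Qed.

(** Before the first point [i] moved by [s] the two permutations agree, and at [i] the values
    compared are [p (s i)] and [p i], with [i < s i]. *)
Lemma lex_lt_permMl s p : s != 1%g ->
  (forall i : 'I_n, (i < s i)%N -> (p (s i) < p i)%N) -> lex_lt (s * p)%g p.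
Proof.
move=> /first_moved[i lt_i fix_lt] dec; apply/lex_ltP.
by exists i => [|j /fix_lt eq_j]; rewrite permM ?eq_j // dec.
Qed.

Lemma lex_gt_permMl s p : s != 1%g ->
  (forall i : 'I_n, (i < s i)%N -> (p i < p (s i))%N) -> lex_lt p (s * p)%g.
Proof.
move=> /first_moved[i lt_i fix_lt] inc; apply/lex_ltP.
by exists i => [|j /fix_lt eq_j]; rewrite permM ?eq_j // inc.
Qed.

Lemma decreasing_onP p A :
  reflect (forall i j : 'I_n, i \in A -> j \in A -> (i < j)%N -> (p j < p i)%N)
          (decreasing_on p A).
Proof.
apply: (iffP forall_inP) => [dec i j Ai Aj ij|dec i Ai].
  by have /forall_inP/(_ j Aj)/implyP/(_ ij) := dec i Ai.
by apply/forall_inP=> j Aj; apply/implyP; apply: dec.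
Qed.

Lemma decreasing_on0 p : decreasing_on p set0.
Proof. by apply/decreasing_onP=> i j; rewrite inE. Qed.

Lemma longest_decreasing_witness p :
  exists2 A, decreasing_on p A & #|A| = longest_decreasing p.
Proof.
have dec0 : (0 < #|[pred A | decreasing_on p A]|)%N.
  by apply/card_gt0P; exists set0; rewrite inE decreasing_on0.
by have [A decA eqA] := eq_bigmax_cond (fun A : {set 'I_n} => #|A|) dec0; exists A.
Qed.

Definition upper_left p (i : 'I_n) : {set 'I_n} :=
  [set j : 'I_n | (j < i)%N && (p i < p j)%N].

(** The sets [A] leave out [i] itself, so this is one less than the length of the longest decreasing
    subsequence ending at [i]; colours start at 0. *)
Definition decreasing_color p i : nat :=
  \max_(A : {set 'I_n} | decreasing_on p A && (A \subset upper_left p i)) #|A|.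

Lemma decreasing_color_witness p i :
  exists A, [/\ decreasing_on p (i |: A), A \subset upper_left p i
              & #|i |: A| = (decreasing_color p i).+1].
Proof.
pose Q := [pred A : {set 'I_n} | decreasing_on p A && (A \subset upper_left p i)].
have Q0 : (0 < #|Q|)%N.
  by apply/card_gt0P; exists set0; rewrite inE decreasing_on0 sub0set.
have [A /andP[/decreasing_onP decA /subsetP sAi] eqA] :=
  eq_bigmax_cond (fun A : {set 'I_n} => #|A|) Q0.
have gt_i (j : 'I_n) : j \in A -> (j < i)%N /\ (p i < p j)%N.
  by move=> /sAi; rewrite inE => /andP.
exists A; split; last 1 first.
- rewrite cardsU1 /decreasing_color [in RHS]eqA -/Q.
  by case: (boolP (i \in A)) => // /gt_i[]; rewrite ltnn.
- apply/decreasing_onP=> j k; rewrite !inE.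
  move=> /predU1P[->|Aj] /predU1P[->|Ak]; first by rewrite ltnn.
  + by move=> ik; have [] := gt_i _ Ak; rewrite ltnNge ltnW.
  + by have [] := gt_i _ Aj.
  + exact: decA.
- exact/subsetP.
Qed.

Lemma decreasing_color_lt p i : (decreasing_color p i < longest_decreasing p)%N.
Proof.
have [A [decA _ <-]] := decreasing_color_witness p i.
exact: leq_bigmax_cond.
Qed.

(** If [p j < p i], a longest decreasing subsequence ending at [i] could be continued by [j], so the
    colour of [j] would be strictly larger. *)
Lemma decreasing_color_incr p (i j : 'I_n) : (i < j)%N ->
  decreasing_color p i = decreasing_color p j -> (p i < p j)%N.
Proof.
move=> ij eq_c; case: ltngtP => // [ji|/val_inj/perm_inj eq_ij]; last first.
  by rewrite eq_ij ltnn in ij.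
have [A [decA sAi cardA]] := decreasing_color_witness p i.
suff: (#|i |: A| <= decreasing_color p j)%N by rewrite cardA eq_c ltnn.
rewrite /decreasing_color; apply: leq_bigmax_cond.
rewrite decA; apply/subsetP=> k; rewrite !inE => /predU1P[->|/(subsetP sAi)].
  by rewrite ij.
by rewrite inE => /andP[ki ik]; rewrite (ltn_trans ki) // (ltn_trans ji).
Qed.

End Lexicographic.

(** * Linear independence *)

Lemma free_image (K : fieldType) (vT : vectType K) (I : finType) (G : {pred I})
    (X : I -> vT) :
    (forall c : I -> K, \sum_(i in G) c i *: X i = 0 -> {in G, forall i, c i = 0}) ->
  free [seq X i | i <- enum G].
Proof.
move=> indep; apply/(@freeP _ _ _ (map_tuple X (enum_tuple G))) => k sum0 i.
(* Coefficients indexed by positions in [enum G] become a function on all of [I], set to 0 outside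
   [G]. *)
pose c j := if j \in G =P true is ReflectT Gj then k (enum_rank_in Gj j) else 0.
have cE j : c (enum_val j) = k j.
  by rewrite /c; case: eqP => [Gj|]; [rewrite enum_valK_in | rewrite enum_valP].
rewrite -cE; apply: indep (enum_valP i).
rewrite big_enum_val -[RHS]sum0; apply: eq_bigr => j _.
by rewrite cE -tnth_nth tnth_map (tnth_nth (enum_default j)).
Qed.

Section Independence.
Variables (R : realType) (l n : nat).
Local Notation C := R[i].
Local Notation good := [set p : 'S_n | (longest_decreasing p <= l)%N].

Lemma permop_free : free [seq permop R l p | p <- enum good].
Proof.
apply: free_image => c sum0 p; move: p.
(* The order is reversed: coefficients of lexicographically larger permutations are already known to
   vanish. *)
apply: (@strict_order_ind _ (fun s t => lex_lt t s)) => [||p IHp].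
- exact: lex_lt_irr.
- by move=> t s p st tp; apply: lex_lt_trans st.
rewrite inE => good_p.
have lt_l i : (decreasing_color p i < l)%N.
  exact: leq_trans (decreasing_color_lt p i) good_p.
pose f : {ffun 'I_n -> 'I_l} := [ffun i => Ordinal (lt_l i)].
have := congr1 (fun A => tcoef A f (permf f p^-1%g)) sum0.
rewrite tcoef_sum {2}/tcoef lfunE ffunE.
rewrite (bigD1 p) ?inE //= tcoef_permop permfVK eqxx mulr1 big1 ?addr0 //.
move=> s /andP[good_s neq_sp]; rewrite tcoef_permop permfM.
case: eqP => [eq_f|_]; last by rewrite mulr0.
suff lt_ps: lex_lt p s by rewrite IHp ?mul0r.
(* By [eq_f], the permutation [s * p^-1] preserves colours, and [p] increases on each colour
   class. *)
rewrite -[s](mulgKV p); apply: lex_gt_permMl.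
  by apply: contra neq_sp => /eqP sp1; rewrite -[s](mulgKV p) sp1 mul1g.
move=> i lt_i; apply: decreasing_color_incr => //.
by move/ffunP/(_ i)/(congr1 val): eq_f; rewrite !ffunE.
Qed.

End Independence.

(** * Straightening by antisymmetrizers *)

Section Straightening.
Variables (R : realType) (l n : nat).
Local Notation C := R[i].
Local Notation good := [set p : 'S_n | (longest_decreasing p <= l)%N].

(** Among more than [l] positions two carry the same letter; the transposition [t] of these pairs
    off equal entries with opposite signs. *)
Lemma antisymmetrizer_eq0 (A : {set 'I_n}) (p : 'S_n) : (l < #|A|)%N ->
  \sum_(s : 'S_n | perm_on A s) (-1) ^+ s *: permop R l (s * p)%g = 0.
Proof.
move=> lt_lA; apply: tcoef_inj => f g; rewrite tcoef_sum {2}/tcoef lfunE ffunE.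
pose h := permf g p.
have [i [j [Ai Aj neq_ij eq_h]]] :
    exists i j, [/\ i \in A, j \in A, i != j & h i = h j].
  have /dinjectivePn[i Ai [j /andP[neq_ji Aj] eq_h]] : ~~ dinjectiveb h A.
    apply: contraL lt_lA => /dinjectiveP inj_h; rewrite -leqNgt.
    by rewrite -(card_in_image inj_h) -[X in (_ <= X)%N]card_ord max_card.
  by exists i, j; split; rewrite // eq_sym.
pose t := tperm i j.
have hM s : permf h (s * t) = permf h s.
  apply/ffunP=> k; rewrite [LHS]ffunE [RHS]ffunE permM.
  by case: tpermP => // ->.
have on_t : perm_on A t.
  apply/subsetP=> k; rewrite inE; apply: contraR => nAk.
  by rewrite tpermD //; apply: contraNneq nAk => <-.
(* Reindexing by [t] shows that the sum equals its own opposite. *)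
apply/eqP; rewrite -eqNr -sumrN (reindex_inj (mulIg t)) /=; apply/eqP.
apply: eq_big => s.
  apply/idP/idP => on_s; last exact: perm_onM.
  by rewrite -[s](mulgK t) tpermV perm_onM.
move=> _; rewrite !tcoef_permop -!(permfM g p) -/h hM odd_permM odd_tperm neq_ij.
by rewrite signr_addb mulrN1 mulNr opprK.
Qed.

Lemma permop_good_span (p : 'S_n) :
  permop R l p \in <<[seq permop R l p | p <- enum good]>>%VS.
Proof.
move: p; apply: (strict_order_ind (@lex_lt_irr n) (@lex_lt_trans n)) => p IHp.
have [good_p|] := leqP (longest_decreasing p) l.
  by apply/memv_span/map_f; rewrite mem_enum inE.
have [A /decreasing_onP decA <- lt_lA] := longest_decreasing_witness p.
have /eqP := antisymmetrizer_eq0 p lt_lA.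
(* The identity term is solved for; every other [s] permutes [A], where [p] decreases, so [s * p] is
   smaller. *)
rewrite (bigD1 1%g) ?perm_on1 //= odd_perm1 scale1r mul1g addr_eq0 => /eqP ->.
rewrite memvN; apply: memv_suml => s /andP[on_s s_neq1]; apply/memvZ/IHp.
apply: lex_lt_permMl s_neq1 _ => i lt_i.
have Ai : i \in A.
  apply: contraLR lt_i => nAi.
  by rewrite (out_perm on_s nAi) ltnn.
by apply: decA => //; rewrite perm_closed.
Qed.

End Straightening.

(** * Polarization by inclusion-exclusion *)

Section Polarization.
Variables (C : comNzRingType) (I : finType).

(** Both sides are the product over [i] of [1 - (i \notin T)], expanded by the set [S] of factors
    contributing 1. *)
Lemma sum_sign_superset (T : {set I}) :
  \sum_(S : {set I} | T \subset S) (-1) ^+ #|~: S| = (T == setT)%:R :> C.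
Proof.
have -> : (T == setT)%:R = \prod_i (1 + - (i \notin T)%:R) :> C.
  case: eqVneq => [->|neqT].
    by rewrite big1 // => i _; rewrite in_setT oppr0 addr0.
  have /subsetPn[i _ nTi] : ~~ (setT \subset T) by rewrite subTset.
  by rewrite (bigD1 i) //= nTi subrr mul0r.
rewrite bigA_distr big_mkcond; apply: eq_bigr => S _.
case: ifPn => [sTS|/subsetPn[i Ti nSi]]; last first.
  by rewrite (bigD1 i) //= (negPf nSi) Ti oppr0 mul0r.
rewrite -prodr_const [LHS]big_mkcond; apply: eq_bigr => i _.
rewrite in_setC; case: (boolP (i \in S)) => //= nSi.
by rewrite (contra (subsetP sTS i) nSi).
Qed.

(** Ryser's formula for the permanent: expand the product over maps [h]; the signed sum over the
    sets [S] containing the image of [h] is zero unless [h] is onto, hence a permutation. *)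
Lemma polarization (x : I -> I -> C) :
  \sum_(S : {set I}) (-1) ^+ #|~: S| * \prod_j \sum_(i in S) x i j
    = \sum_(s : {perm I}) \prod_j x (s j) j.
Proof.
under eq_bigr => S _ do rewrite bigA_distr_big mulr_sumr.
rewrite (exchange_big_dep xpredT) //=.
have im_inj (h : {ffun I -> I}) : (h @: setT == setT) = injectiveb h.
  apply/eqP/injectiveP => [eq_im|inj_h].
    have /imset_injP inj_h : #|h @: setT| == #|[set: I]| by rewrite eq_im.
    by move=> i j; apply: inj_h; rewrite inE.
  by apply/eqP; rewrite eqEcard subsetT card_imset /=.
have inner (h : {ffun I -> I}) :
    \sum_(S : {set I} | h \in ffun_on (mem S)) (-1) ^+ #|~: S| * \prod_j x (h j) j
      = (injectiveb h)%:R * \prod_j x (h j) j.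
  rewrite -mulr_suml -im_inj -sum_sign_superset; congr (_ * _).
  apply: eq_bigl => S; apply/ffun_onP/subsetP => [hS _ /imsetP[i _ ->] //|hS i].
  exact/hS/imset_f.
under eq_bigr do rewrite inner.
rewrite (bigID (fun h : {ffun I -> I} => injectiveb h)) /= addrC.
rewrite big1 ?add0r; last first.
  by move=> h /negPf ->; rewrite mul0r.
rewrite (reindex (fun s : {perm I} => val s)) /=; last first.
  exists (insubd (1%g : {perm I})) => h inj_h; first exact: valKd.
  exact: insubdK.
apply: eq_big => s; first exact: (valP s).
by move=> ->; rewrite mul1r; apply: eq_bigr => j _; rewrite pvalE.
Qed.

End Polarization.

(** * Gram systems and points of the unit circle *)

Local Open Scope sesquilinear_scope.

(** If [X] is killed by [T^t* *m T], the columns of [T *m X] have norm zero, so [X] is killed by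
    [T]. *)
Lemma submx_gram (C : numClosedFieldType) m n (T : 'M[C]_(m, n)) :
  (T <= T^t* *m T)%MS.
Proof.
rewrite submxE; set X := cokermx _.
have: (T *m X)^t* *m (T *m X) = 0.
  by rewrite trmx_mul map_mxM -mulmxA [_ *m (T *m X)]mulmxA mulmx_coker mulmx0.
move=> /matrixP gram0; apply/eqP/matrixP=> i j; rewrite [RHS]mxE.
have := gram0 j j; rewrite [in X in X -> _]mxE [X in _ = X -> _]mxE.
under eq_bigr => k _ do rewrite [_^t* _ _]mxE [_^T _ _]mxE mulrC -normCK.
move/eqP; rewrite psumr_eq0 => [/allP/(_ i (mem_index_enum _))|k _].
  by rewrite expf_eq0 /= normr_eq0 => /eqP.
exact: exprn_ge0.
Qed.

Lemma gram_bool (C : numClosedFieldType) (I J : finType) (t : I -> J -> bool) i0 :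
  exists y : J -> C, forall j,
    \sum_i (\sum_k (t i k)%:R * y k) * (t i j)%:R = (t i0 j)%:R.
Proof.
pose T : 'M[C]_(#|I|, #|J|) := \matrix_(i, j) (t (enum_val i) (enum_val j))%:R.
have /submxP[D defT] := submx_gram T.
(* The solution is the row of [D] at [i0]; conjugation fixes the Boolean entries of [T]. *)
exists (fun j => D (enum_rank i0) (enum_rank j)) => j.
have := congr1 (fun M : 'M_(_, _) => M (enum_rank i0) (enum_rank j)) defT.
rewrite mulmxA !mxE !enum_rankK => ->.
rewrite (reindex _ (onW_bij _ (enum_val_bij I))) /=; apply: eq_bigr => i _.
rewrite !mxE enum_rankK (reindex _ (onW_bij _ (enum_val_bij J))) /=.
congr (_ * _); apply: eq_bigr => k _.
by rewrite !mxE enum_valK conjC_nat mulrC.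
Qed.

(** The points are Cayley transforms of the natural numbers: a quotient of two conjugates has
    modulus 1. *)
Lemma unit_circle_infinite (C : numClosedFieldType) :
  exists2 z : nat -> C, injective z & forall k, `|z k| = 1.
Proof.
have nz k : k%:R - 'i != 0 :> C.
  rewrite subr_eq0; apply/eqP=> /(congr1 (fun x => x ^+ 2)); rewrite sqrCi.
  by move/eqP; rewrite -subr_eq0 opprK -natrX natr1 pnatr_eq0.
exists (fun k => (k%:R + 'i) / (k%:R - 'i)) => [j k /eqP|k].
  rewrite eqr_div ?nz // => /eqP.
  move/eqP; rewrite -subr_eq0.
  have ->: (j%:R + 'i) * (k%:R - 'i) - (k%:R + 'i) * (j%:R - 'i)
      = 2%:R * 'i * (k%:R - j%:R) :> C by ring.
  rewrite !mulf_eq0 pnatr_eq0 (negPf (neq0Ci _)) /= subr_eq0 eqr_nat.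
  by move/eqP.
rewrite normf_div; have -> : k%:R - 'i = (k%:R + 'i)^* :> C.
  by rewrite rmorphD /= conjC_nat conjCi.
by rewrite norm_conjC divff // -norm_conjC rmorphD /= conjC_nat conjCi normr_eq0.
Qed.

(** * The commutant of the tensor powers *)

Section Commutant.
Variables (R : realType) (l n : nat).
Local Notation C := R[i].
Local Notation V := (tensor_space R l n).
Local Notation F := {ffun 'I_n -> 'I_l}.
Variable A : 'End(V).

(** Commutation entry by entry, which for fixed [f] and [g] is a polynomial identity in the entries
    of [U]. *)
Definition commutes_with_power (U : 'M[C]_l) : Prop :=
  forall f g : F, \sum_(h : F) tcoef A f h * \prod_i U (h i) (g i)
                = \sum_(h : F) \prod_i U (f i) (h i) * tcoef A h g.

Lemma commutes_with_power_comp U :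
  (A \o tensor_power n U = tensor_power n U \o A)%VF -> commutes_with_power U.
Proof.
move=> eqAU f g; have := congr1 (fun B => tcoef B f g) eqAU; rewrite !tcoef_comp.
under eq_bigr => h _ do rewrite tcoef_tensor_power.
by under [RHS]eq_bigr => h _ do rewrite tcoef_tensor_power.
Qed.

Lemma commutes_with_power_line (z : nat -> C) (M N : 'M[C]_l) : injective z ->
    (forall k, commutes_with_power (M + z k *: N)) ->
  forall t, commutes_with_power (M + t *: N).
Proof.
move=> z_inj comm_z t f g.
pose L i j : {poly C} := (M i j)%:P + (N i j)%:P * 'X.
pose p := \sum_(h : F) (tcoef A f h)%:P * \prod_i L (h i) (g i)
        - \sum_(h : F) \prod_i L (f i) (h i) * (tcoef A h g)%:P.
have pE u : p.[u] = \sum_(h : F) tcoef A f h * \prod_i (M + u *: N) (h i) (g i)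
        - \sum_(h : F) \prod_i (M + u *: N) (f i) (h i) * tcoef A h g.
  have LE i j : (L i j).[u] = (M + u *: N) i j by rewrite !hornerE !mxE mulrC.
  rewrite hornerD hornerN !horner_sum.
  by congr (_ - _); apply: eq_bigr => h _; rewrite hornerM hornerC horner_prod;
    (under eq_bigr do rewrite LE).
have p0 : p = 0.
  (* A nonzero [p] has degree [size p - 1], so [size p] distinct roots force it to vanish. *)
  apply: (@roots_geq_poly_eq0 _ _ [seq z k | k <- iota 0 (size p)]).
  - by apply/allP=> _ /mapP[k _ ->]; rewrite /root pE comm_z subrr.
  - by rewrite map_inj_uniq ?iota_uniq.
  - by rewrite size_map size_iota.
by apply/eqP; rewrite -subr_eq0 -pE p0 horner0.
Qed.

Hypothesis commA : unitary_commutant A.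

Lemma commutes_with_power_normal (M : 'M[C]_l) :
  M \is normalmx -> commutes_with_power M.
Proof.
move=> /orthomx_spectralP ->; set P := spectralmx M.
have Punit : P \is unitarymx := spectral_unitarymx M.
rewrite invmx_unitary //; move: (spectral_diag M) => d.
(* Induction on the list of indices whose eigenvalue may lie off the unit circle; for the empty list
   the matrix is unitary. *)
have: forall i, i \notin enum 'I_l -> `|d 0 i| = 1.
  by move=> i; rewrite mem_enum.
elim: (enum _) d => [|i s IHs] d d1.
  apply/commutes_with_power_comp/commA/unitarymxP.
  rewrite !trmx_mul !map_mxM trmxCK -!mulmxA.
  rewrite [P *m (_ *m _)]mulmxA (unitarymxP Punit) mul1mx.
  rewrite [diag_mx d *m _]mulmxA tr_diag_mx map_diag_mx mulmx_diag.
  have -> : (\row_j (d 0 j * (map_mx Num.Def.conjC d) 0 j)) = const_mx 1.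
    by apply/rowP=> j; rewrite !mxE -normCK d1 ?expr1n.
  rewrite diag_const_mx mul1mx -invmx_unitary // mulVmx //.
  exact: unitarymx_unit.
have [z z_inj z1] := unit_circle_infinite C.
(* With the eigenvalue at [i] replaced by 0, the parameter [t] of the line is exactly that
   eigenvalue. *)
pose e : 'rV[C]_l := \row_j if j == i then 0 else d 0 j.
have line t : P^t* *m diag_mx e *m P + t *: (P^t* *m diag_mx (delta_mx 0 i) *m P)
    = P^t* *m diag_mx (e + t *: delta_mx 0 i) *m P.
  by rewrite linearD linearZ mulmxDr mulmxDl -scalemxAr -scalemxAl.
have -> : d = e + d 0 i *: delta_mx 0 i.
  apply/rowP=> j; rewrite !mxE eqxx /=; case: eqVneq => [->|_].
    by rewrite add0r mulr1.
  by rewrite mulr0 addr0.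
rewrite -line; apply: commutes_with_power_line z_inj _ _ => k.
rewrite line; apply: IHs => j s'j; rewrite !mxE eqxx /=.
case: eqVneq => [_|neq_ji]; first by rewrite add0r mulr1 z1.
by rewrite mulr0 addr0 d1 // inE negb_or neq_ji.
Qed.

Lemma commutes_with_power_all (M : 'M[C]_l) : commutes_with_power M.
Proof.
pose X := 2%:R^-1 *: (M + M^t*); pose Y := (2%:R * 'i)^-1 *: (M - M^t*).
have -> : M = X + 'i *: Y.
  rewrite /X /Y scalerA invfM mulrCA divff ?neq0Ci // mulr1 -scalerDr.
  rewrite addrACA subrr addr0.
  by rewrite -mulr2n -[M *+ 2]scaler_nat scalerA mulVf ?pnatr_eq0 // scale1r.
(* [X] and [Y] are Hermitian, hence so is [X + k *: Y] for natural [k]; the target is the point ['i]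
   of this line. *)
apply: (@commutes_with_power_line (fun k => k%:R)) => [j k /eqP|k].
  by rewrite eqr_nat => /eqP.
apply: commutes_with_power_normal; apply/normalmxP.
suff -> : (X + k%:R *: Y)^t* = X + k%:R *: Y by [].
apply/matrixP=> i j; rewrite !mxE !(rmorphD, rmorphM, rmorphN, fmorphV) /=.
rewrite !conjC1 -[1 + 1]/(2%:R) conjC_nat conjCi conjCK mulrN invrN; ring.
Qed.

Lemma commutes_with_symmetrization (f g h k : F) :
  \sum_(s : 'S_n) tcoef A h (permf f s) * (k == permf g s)%:R
    = \sum_(s : 'S_n) (h == permf f s)%:R * tcoef A (permf g s) k.
Proof.
(* [E] is the symmetrized matrix unit at [(f, g)]; polarization turns it into a signed sum of tensor
   powers of the matrices [M S]. *)
pose E (h k : F) : C := \sum_(s : 'S_n) (h == permf f s)%:R * (k == permf g s)%:R.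
pose M (S : {set 'I_n}) : 'M[C]_l := \sum_(i in S) delta_mx (f i) (g i).
have EE (u v : F) :
    E u v = \sum_(S : {set 'I_n}) (-1) ^+ #|~: S| * \prod_j M S (u j) (v j).
  transitivity (\sum_(s : 'S_n)
      \prod_j ((u j == f (s j)) && (v j == g (s j)))%:R : C).
    apply: eq_bigr => s _; rewrite -!prod_delta -big_split.
    by apply: eq_bigr => j _; rewrite /= !ffunE -natrM mulnb.
  rewrite -(polarization (fun i j => ((u j == f i) && (v j == g i))%:R)).
  apply: eq_bigr => S _; congr (_ * _); apply: eq_bigr => j _.
  by rewrite summxE; apply: eq_bigr => i _; rewrite mxE.
have commE : \sum_u tcoef A h u * E u k = \sum_u E h u * tcoef A u k.
  under eq_bigr => u _ do rewrite EE mulr_sumr.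
  under [RHS]eq_bigr => u _ do rewrite EE mulr_suml.
  rewrite exchange_big [RHS]exchange_big; apply: eq_bigr => S _ /=.
  under eq_bigr do rewrite mulrCA.
  under [RHS]eq_bigr do rewrite -mulrA.
  by rewrite -!mulr_sumr commutes_with_power_all.
transitivity (\sum_u tcoef A h u * E u k).
  under [RHS]eq_bigr => u _ do rewrite mulr_sumr.
  rewrite exchange_big; apply: eq_bigr => s _ /=.
  by under [RHS]eq_bigr do rewrite mulrA; rewrite -mulr_suml sum_delta.
rewrite commE.
under eq_bigr => u _ do rewrite mulr_suml.
rewrite exchange_big; apply: eq_bigr => s _ /=.
by under eq_bigr do rewrite mulrAC; rewrite sum_delta.
Qed.

Lemma commutant_permop :
  exists c : 'S_n -> C, A = \sum_s c s *: permop R l s.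
Proof.
(* The 0-1 row of [s] lists the entries of [permop R l s]. Pairing it with [y] gives weights for
   which, by [yP], the weighted sum of the permutation operators is the identity. *)
have [y yP] := gram_bool C (fun (s : 'S_n) (u : F * F) => u.1 == permf u.2 s) 1%g.
exists (fun s => \sum_u tcoef A (permf u.2 s) u.1 * y u).
apply: tcoef_inj => h f; rewrite tcoef_sum.
under [RHS]eq_bigr => s _ do rewrite tcoef_permop mulr_suml.
rewrite exchange_big /=.
(* The symmetrization relation moves the sum over [s] to the column index of [A], leaving [y] paired
   with the row of [s]. *)
under [RHS]eq_bigr => u _.
  under eq_bigr do rewrite mulrC mulrA.
  rewrite -mulr_suml -commutes_with_symmetrization mulr_suml.
  over.
rewrite exchange_big /= -[LHS](sum_delta (tcoef A h)).
(* The delta is an entry of the identity and is replaced by the weighted sum from [yP]. *)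
under [LHS]eq_bigr => g _.
  have := yP (g, f); rewrite /= permf1 => <-; rewrite mulr_sumr.
  over.
rewrite exchange_big; apply: eq_bigr => s _ /=.
under eq_bigr do rewrite mulrCA mulrC.
rewrite -mulr_suml sum_delta mulr_sumr.
by apply: eq_bigr => u _; rewrite mulrA.
Qed.

End Commutant.

Local Close Scope sesquilinear_scope.

Theorem theorem8p2 (R : realType) (l n : nat) :
  let B : seq 'End(tensor_space R l n) :=
    [seq permop R l pi | pi <- enum [set pi : 'S_n | (longest_decreasing pi <= l)%N]] in
  free B /\
  (forall A : 'End(tensor_space R l n),
     A \in <<B>>%VS <-> unitary_commutant A).
Proof.
split; first exact: permop_free.
move=> A; split=> [|commA].
  apply: unitary_commutant_span => _ /mapP[p _ ->].
  exact: permop_commutant.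
have [c ->] := commutant_permop commA.
by apply: memv_suml => p _; apply/memvZ/permop_good_span.
Qed.
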